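(* Let $f$ be a probability density function on $\Omega=\{(x,y)\in\mathbb{R}^2:y>x\ge0\}$ with respect to two-dimensional Lebesgue measure. Then there is a probability distribution $P$ on $\mathbf{PD}$, induced by $f$ (i.e. the pushforward of $f\,dx$ under $\Phi:\Omega\to\mathbf{PD}$, $\Phi(x)=\delta_x$), whose persistence intensity function is $f$.
   Context: $\mathbf{PD}$ is the space of locally finite integer-valued measures on $\Omega$ (persistence diagrams), with the $\sigma$-field generated by the evaluation maps $D\mapsto D(B)$ for $B\subseteq\Omega$ relatively compact Borel. For a random element $D$ of $\mathbf{PD}$ with distribution $P$, the expectation measure is $\mathbb{E}(D)(B)=\mathbb{E}[D(B)]$ for Borel $B\subseteq\Omega$; the persistence intensity function of $P$ is the density of $\mathbb{E}(D)$ with respect to Lebesgue measure on $\Omega$, when it exists. *)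

(* Defs.v *)
From HB Require Import structures.
From mathcomp Require Import all_boot all_order all_algebra.
From mathcomp Require Import all_classical all_reals all_analysis.
From mathcomp Require Import measurable_realfun.

Set Implicit Arguments.
Unset Strict Implicit.
Unset Printing Implicit Defensive.

Import Order.TTheory GRing.Theory Num.Theory.
Import numFieldNormedType.Exports.

Local Open Scope classical_set_scope.
Local Open Scope ring_scope.

Section Omega.
Context (R : realType).

(* [measurableTypeR R] is [R] with the Borel sigma-algebra on which
   [lebesgue_measure] is defined; its topology is that of [R]. *)
Definition plane : Type := (measurableTypeR R * measurableTypeR R)%type.

HB.instance Definition _ := Topological.on plane.
HB.instance Definition _ := Measurable.on plane.

Definition lebesgue_plane : set plane -> \bar R :=
  ((@lebesgue_measure R) \x (@lebesgue_measure R))%E.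

HB.instance Definition _ := Measure.on lebesgue_plane.

Definition Omega_set : set plane := [set p : R * R | 0 <= p.1 < p.2].

(* A type of its own, carrying the subspace topology and the Borel
   sigma-algebra generated by it. *)
Definition Omega : Type := set_type Omega_set.

Lemma Omega_point_subproof : ((0, 1) : plane) \in Omega_set.
Proof. by rewrite inE /Omega_set /= lexx ltr01. Qed.

HB.instance Definition _ := Topological.copy Omega (set_type Omega_set).
HB.instance Definition _ := isPointed.Build Omega
  (exist (fun p => p \in Omega_set) (0, 1) Omega_point_subproof).

Definition Omega_borel : set (set Omega) := <<s @open Omega >>.

Definition Omega_display : measure_display.
Proof. by constructor. Qed.

Let Omega_borel0 : Omega_borel set0.
Proof. exact: sigma_algebra0. Qed.

Let Omega_borelC A : Omega_borel A -> Omega_borel (~` A).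
Proof. exact: sigma_algebraC. Qed.

Let Omega_borelU (F : (set Omega)^nat) :
  (forall i, Omega_borel (F i)) -> Omega_borel (\bigcup_i F i).
Proof. exact: sigma_algebra_bigcup. Qed.

HB.instance Definition _ := @isMeasurable.Build Omega_display Omega Omega_borel
  Omega_borel0 Omega_borelC Omega_borelU.

Definition Omega_val : Omega -> plane := set_val.

Lemma open_measurable_plane (U : set plane) : open U -> measurable U.
Proof.
move=> oU.
pose B (q : (rat * rat) * (rat * rat)) : set plane :=
  ball (ratr q.1.1 : R) (ratr q.1.2) `*` ball (ratr q.2.1 : R) (ratr q.2.2).
rewrite (_ : U = \bigcup_(q in [set q | B q `<=` U]) B q); last first.
  apply/seteqP; split=> [[x y] Uxy|p [q /= + Bp]]; last by apply.
  have [[/= V W] [Vx Wy] VWU] := open_nbhs_nbhs (conj oU Uxy).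
  move: Vx; rewrite nbhsE/= => -[V' [oV' V'x] V'V].
  move: Wy; rewrite nbhsE/= => -[W' [oW' W'y] W'W].
  have [c [r [+ crV]]] := open_subball_rat oV' (mem_set V'x).
  have [d [s [+ dsW]]] := open_subball_rat oW' (mem_set W'y).
  rewrite !inE => By Bx.
  exists ((c, r), (d, s)); last by split.
  move=> [u v] [/= Bu Bv]; apply: VWU; split => /=.
    exact/V'V/crV.
  exact/W'W/dsW.
rewrite bigcup_mkcond; apply: countable_bigcupT_measurable => // q.
by case: ifPn => // _; apply: measurableX; exact: measurable_ball.
Qed.

Lemma measurable_Omega_set : measurable Omega_set.
Proof.
rewrite (_ : Omega_set = (`[0, +oo[ `*` setT) `&`
                         ([set: plane] `&` (fun p : R * R => p.1 < p.2) @^-1` [set true])).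
  apply: measurableI; first by apply: measurableX => //; exact: measurable_itv.
  have m1 : measurable_fun [set: plane] (fst : plane -> R) by exact: measurable_fst.
  have m2 : measurable_fun [set: plane] (snd : plane -> R) by exact: measurable_snd.
  exact: (measurable_fun_ltr m1 m2).
apply/seteqP; split=> [[x y] /= /andP[x0 xy]|[x y] /= [[+ _] [_ xy]]].
  by rewrite in_itv /= x0.
by rewrite in_itv /= andbT => x0; apply/andP; split.
Qed.

Lemma measurable_Omega_image (B : set Omega) :
  measurable B -> measurable (Omega_val @` B).
Proof.
move=> mB.
have [A mA <-] : preimage_set_system setT Omega_val measurable B.
  move: B mB; apply: smallest_sub.
    exact: sigma_algebra_preimage (sigma_algebra_measurable plane).
  move=> _ [U oU <-]; exists U; first exact: open_measurable_plane.
  by rewrite setTI.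
rewrite (_ : _ @` _ = Omega_set `&` A).
  exact: measurableI measurable_Omega_set mA.
apply/seteqP; split=> [_ [x [_ Ax] <-]|p [Op Ap]].
  by split => //; exact: set_valP.
by exists (exist (fun p => p \in Omega_set) p (mem_set Op)).
Qed.

Definition lebesgue_Omega (B : set Omega) : \bar R :=
  lebesgue_plane (Omega_val @` B).

Let lebesgue_Omega0 : lebesgue_Omega set0 = 0%E.
Proof. by rewrite /lebesgue_Omega image_set0 measure0. Qed.

Let lebesgue_Omega_ge0 B : (0 <= lebesgue_Omega B)%E.
Proof. exact: measure_ge0. Qed.

Let lebesgue_Omega_sigma_additive : semi_sigma_additive lebesgue_Omega.
Proof.
move=> F mF tF mUF; rewrite /lebesgue_Omega image_bigcup.
apply: measure_semi_sigma_additive.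
- by move=> i; exact: measurable_Omega_image.
- apply/trivIsetP => i j _ _ ij; apply/seteqP; split=> // p [[x Fx <-] [y Fy]].
  move/val_inj => yx; rewrite yx in Fy.
  move/trivIsetP : tF => /(_ i j Logic.I Logic.I ij)/seteqP[/(_ x) FijP _].
  exact: FijP (conj Fx Fy).
- by rewrite -image_bigcup; exact: measurable_Omega_image.
Qed.

HB.instance Definition _ := isMeasure.Build _ _ _ lebesgue_Omega
  lebesgue_Omega0 lebesgue_Omega_ge0 lebesgue_Omega_sigma_additive.

End Omega.

Section PD.
Context (R : realType).
Local Open Scope ereal_scope.

Definition integer_valued (mu : set (Omega R) -> \bar R) :=
  forall B : set (Omega R), measurable B ->
    mu B = +oo \/ exists n : nat, mu B = n%:R%:E.

(* [precompact] refers to the topology of [Omega R]: points may accumulate at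
   the diagonal, which lies outside [Omega R]. *)
Definition locally_finite (mu : set (Omega R) -> \bar R) :=
  forall B : set (Omega R), measurable B -> precompact B -> mu B < +oo.

Record PD : Type := MkPD {
  PD_measure :> {measure set (Omega R) -> \bar R} ;
  PD_integer_valued : integer_valued PD_measure ;
  PD_locally_finite : locally_finite PD_measure }.

Lemma mzero_integer_valued : integer_valued (@mzero _ (Omega R) R).
Proof. by move=> B _; right; exists 0%N. Qed.

Lemma mzero_locally_finite : locally_finite (@mzero _ (Omega R) R).
Proof. by move=> B _ _; exact: ltry. Qed.

HB.instance Definition _ := gen_eqMixin PD.
HB.instance Definition _ := gen_choiceMixin PD.
HB.instance Definition _ :=
  isPointed.Build PD (MkPD mzero_integer_valued mzero_locally_finite).

Definition PD_measurable : set (set PD) :=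
  <<s \bigcup_(B in [set B : set (Omega R) | measurable B /\ precompact B])
        preimage_set_system [set: PD] (fun D : PD => D B) measurable >>.

Let PD_measurable0 : PD_measurable set0.
Proof. exact: sigma_algebra0. Qed.

Let PD_measurableC A : PD_measurable A -> PD_measurable (~` A).
Proof. exact: sigma_algebraC. Qed.

Let PD_measurableU (F : (set PD)^nat) :
  (forall i, PD_measurable (F i)) -> PD_measurable (\bigcup_i F i).
Proof. exact: sigma_algebra_bigcup. Qed.

Definition PD_display : measure_display.
Proof. by constructor. Qed.

HB.instance Definition _ := @isMeasurable.Build PD_display PD PD_measurable
  PD_measurable0 PD_measurableC PD_measurableU.

Lemma dirac_integer_valued (x : Omega R) : integer_valued (@dirac _ _ x R).
Proof. by move=> B _; right; exists (x \in B); rewrite diracE. Qed.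

Lemma dirac_locally_finite (x : Omega R) : locally_finite (@dirac _ _ x R).
Proof. by move=> B _ _; rewrite diracE ltry. Qed.

Definition Phi (x : Omega R) : PD :=
  MkPD (dirac_integer_valued x) (dirac_locally_finite x).

Definition is_density d (T : measurableType d)
    (mu nu : set T -> \bar R) (f : T -> R) :=
  [/\ measurable_fun [set: T] f, forall x, (0 <= f x)%R &
      forall B, measurable B -> mu B = \int[nu]_(x in B) (f x)%:E].

Definition is_pdf (f : Omega R -> R) :=
  [/\ measurable_fun [set: Omega R] f, forall x, (0 <= f x)%R &
      \int[@lebesgue_Omega R]_x (f x)%:E = 1].

Definition density_measure (f : Omega R -> R) (A : set (Omega R)) : \bar R :=
  \int[@lebesgue_Omega R]_(x in A) (f x)%:E.

Definition expectation_measure d (T : measurableType d) (Q : probability T R)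
    (D : {RV Q >-> PD}) (B : set (Omega R)) : \bar R :=
  \int[Q]_w D w B.

(* The expectation measure depends only on the distribution of the random
   diagram, so all of those with distribution [P] are considered, on whatever
   probability space they are defined. There is at least one: the identity
   on [PD] equipped with [P]. *)
Definition is_persistence_intensity (P : probability PD R) (f : Omega R -> R) :=
  forall d (T : measurableType d) (Q : probability T R) (D : {RV Q >-> PD}),
    (forall A, measurable A -> distribution Q D A = P A) ->
    is_density (expectation_measure D) (@lebesgue_Omega R) f.

End PD.

(* Main.v *)
(* A diagram with the distribution of [Phi x], [x ~ f], puts mass [dirac x B] on
   [B], whose mean is the [f]-mass of [B]. The change of variables needs every
   evaluation [D |-> D B] to be measurable. *)
Require Import Defs.
From HB Require Import structures.
From mathcomp Require Import all_boot all_order all_algebra.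
From mathcomp Require Import all_classical all_reals all_analysis.
From mathcomp Require Import measurable_realfun.

Local Open Scope classical_set_scope.

Import Order.TTheory GRing.Theory Num.Theory.
Import numFieldNormedType.Exports.

(** Push a filter on the subtype forward along [set_val]: it clusters at some [p] in [C], and [C]
    inside [A] makes [p] a point of the subtype. Open sets of the subtype are traces of open sets,
    so the filter clusters at [p] there too. *)
Lemma compact_set_val_preimage (T : topologicalType) (A C : set T) :
  C `<=` A -> compact C -> compact (set_val @^-1` C : set (set_type A)).
Proof.
move=> CA cC F PF FC.
have [|p [Cp clp]] := cC (set_val @ F) _; first exact: FC.
have Ap : p \in A by rewrite inE; exact: CA.
exists (SigSub Ap : set_type A); split=> //= U V FU.
rewrite nbhsE => -[_ [[W oW <-] Wp] WV].
have FI : (set_val @ F) (set_val @` U).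
  by apply: (@filterS _ F _ U) => // x Ux; exists x.
have [_ [[x Ux <-] Wx]] := clp _ W FI (open_nbhs_nbhs (conj oW Wp)).
by exists x; split=> //; exact: WV.
Qed.

Local Open Scope ring_scope.

(** Stage [n] of a compact exhaustion of Omega; the gap from the diagonal keeps it closed in the
    plane. With [n] in place of [n.+1], the convention [0^-1 = 0] would admit the origin at
    [n = 0]. *)
Definition plane_core (R : realType) (n : nat) : set (plane R) :=
  [set p : R * R | [/\ 0 <= p.1, p.2 <= n%:R & n.+1%:R^-1 <= p.2 - p.1]].

Lemma plane_core_Omega (R : realType) n : plane_core R n `<=` @Omega_set R.
Proof.
move=> p [p0 _ np]; rewrite /Omega_set/= p0/= -subr_gt0.
by apply: lt_le_trans np; rewrite invr_gt0.
Qed.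

Lemma closed_plane_core (R : realType) n : closed (plane_core R n).
Proof.
have c1 : continuous (fst : R * R -> R) by move=> p; exact: cvg_fst.
have c2 : continuous (snd : R * R -> R) by move=> p; exact: cvg_snd.
have cB : continuous (fun p : R * R => p.2 - p.1).
  by move=> p; apply: cvgB; [exact: c2|exact: c1].
rewrite (_ : plane_core R n = (fst : R * R -> R) @^-1` [set x | 0 <= x] `&`
    (snd : R * R -> R) @^-1` [set x | x <= n%:R] `&`
    (fun p : R * R => p.2 - p.1) @^-1` [set x | n.+1%:R^-1 <= x]); last first.
  by apply/seteqP; split => [p []|p [[]]].
apply: closedI; first apply: closedI.
- by apply: preimage_closed => [p _|]; [exact: c1|exact: closed_ge].
- by apply: preimage_closed => [p _|]; [exact: c2|exact: closed_le].
- by apply: preimage_closed => [p _|]; [exact: cB|exact: closed_ge].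
Qed.

Lemma compact_plane_core (R : realType) n : compact (plane_core R n).
Proof.
(* The core lies in a square, since [p.1 < p.2] passes each bound on one coordinate to the other. *)
apply: (@subclosed_compact _ _ ((`[0, n%:R] : set R) `*` (`[0, n%:R] : set R))).
- exact: closed_plane_core.
- by apply: compact_setX; exact: segment_compact.
- move=> p Cp; have /andP[_ /ltW p12] := @plane_core_Omega _ _ _ Cp.
  case: Cp => p0 pn _; split; rewrite /= in_itv/= ?p0 ?pn ?andbT.
    exact: le_trans pn.
  exact: le_trans p12.
Qed.

Definition Omega_core (R : realType) n : set (Omega R) :=
  @Omega_val R @^-1` plane_core R n.

Lemma closed_Omega_core (R : realType) n : closed (Omega_core R n).
Proof.
apply: (@preimage_closed (Omega R) (plane R) (@Omega_val R)).
  by move=> x _; exact: initial_continuous.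
exact: closed_plane_core.
Qed.

Lemma precompact_Omega_core (R : realType) n : precompact (Omega_core R n).
Proof.
rewrite precompact_closed; last exact: closed_Omega_core.
exact: compact_set_val_preimage (@plane_core_Omega R n) (@compact_plane_core R n).
Qed.

Lemma measurable_Omega_core (R : realType) n : measurable (Omega_core R n).
Proof.
rewrite -[X in measurable X]setCK; apply: measurableC.
by apply: sub_sigma_algebra; apply: closed_openC; exact: closed_Omega_core.
Qed.

Lemma nondecreasing_Omega_core (R : realType) : nondecreasing_seq (Omega_core R).
Proof.
move=> m n mn; apply/subsetPset => x [x0 xm mx]; split=> //.
  by apply: le_trans xm _; rewrite ler_nat.
by apply: le_trans mx; rewrite lef_pV2 ?posrE ?ler_nat.
Qed.

Lemma bigcup_Omega_core (R : realType) : \bigcup_n Omega_core R n = setT.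
Proof.
apply/seteqP; split=> // x _.
have /andP[x0 x12] : 0 <= (Omega_val x).1 < (Omega_val x).2 := set_valP x.
have [m /ltW xm] := ltr_add_invr x12.
have [n /ltW xn] : exists n, (Omega_val x).2 < n%:R.
  by exists (Num.truncn (Omega_val x).2).+1; exact: truncnS_gt.
(* [m] controls the gap from the diagonal and [n] the height; the larger index meets both bounds. *)
exists (maxn m n) => //; split=> //.
  by apply: le_trans xn _; rewrite ler_nat leq_maxr.
apply: (@le_trans _ _ (m.+1%:R^-1)).
  by rewrite lef_pV2 ?posrE// ler_nat ltnS leq_maxl.
by rewrite lerBrDl.
Qed.

Local Open Scope ereal_scope.

(* The sigma-field of [PD] is generated by evaluations on relatively compact
   sets only; the other Borel sets are reached by monotone exhaustion. *)
Lemma measurable_PD_eval (R : realType) (B : set (Omega R)) :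
  measurable B -> measurable_fun [set: PD R] (fun D : PD R => D B).
Proof.
move=> mB; have mI n : measurable (B `&` Omega_core R n).
  by apply: measurableI => //; exact: measurable_Omega_core.
apply: (emeasurable_fun_cvg (fun n (D : PD R) => D (B `&` Omega_core R n))).
  (* The trace of [B] on a core is precompact, so preimages under its evaluation are generators. *)
  move=> n _ Y mY; apply: sub_sigma_algebra.
  exists (B `&` Omega_core R n); last by exists Y.
  split=> //; apply: precompact_subset (@precompact_Omega_core R n).
  exact: subIsetr.
move=> D _.
have -> : D B = D (\bigcup_n (B `&` Omega_core R n)).
  by rewrite -setI_bigcupr bigcup_Omega_core setIT.
apply: nondecreasing_cvg_mu => //; first exact: bigcupT_measurable.
move=> m n mn; apply/subsetPset; apply: setIS.
by apply/subsetPset; exact: nondecreasing_Omega_core.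
Qed.

(** Only generators need checking, and evaluation at [B] composed with [Phi] is the indicator of
    [B]. *)
Lemma measurable_Phi (R : realType) : measurable_fun [set: Omega R] (@Phi R).
Proof.
apply: measurability; first by [].
move=> _ [_ [B [mB _] [Y mY <-]] <-].
rewrite !setTI -[X in measurable X]setTI.
exact: (measurable_fun_dirac mB).
Qed.

HB.instance Definition _ (R : realType) :=
  isMeasurableFun.Build _ _ (Omega R) (PD R) (@Phi R) (@measurable_Phi R).

Lemma density_probability d (T : measurableType d) (R : realType)
    (mu : {measure set T -> \bar R}) (f : T -> \bar R) :
  measurable_fun setT f -> (forall x, 0 <= f x) -> \int[mu]_x f x = 1 ->
  exists P : probability T R, forall A, P A = \int[mu]_(x in A) f x.
Proof.
move=> mf f0 f1; pose m (A : set T) := \int[mu]_(x in A) f x.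
have m0 : m set0 = 0 by exact: integral_set0.
have m_ge0 A : 0 <= m A by exact: integral_ge0.
have mD : semi_sigma_additive m.
  (* The partial sums increase, hence converge; their limit is the integral over the disjoint union
     because the integrand is nonnegative. *)
  move=> F mF tF mUF; rewrite /m; apply: cvg_toP.
    apply: ereal_nondecreasing_is_cvgn => i j ij.
    by apply: lee_sum_nneg_natr => // k _ _; exact: m_ge0.
  by rewrite ge0_integral_bigcup//; exact: measurable_funTS.
pose m_measure := isMeasure.Build _ _ _ m m0 m_ge0 mD.
pose M : {measure set T -> \bar R} := HB.pack m m_measure.
pose m_prob := Measure_isProbability.Build _ _ _ M f1.
by exists (HB.pack_for (probability T R) m m_measure m_prob).
Qed.

Theorem lemmaG5 (R : realType) (f : Omega R -> R) (hf : is_pdf f) :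
  measurable_fun [set: Omega R] (@Phi R) /\
  exists P : probability (PD R) R,
    (forall A : set (PD R), measurable A ->
       P A = pushforward (density_measure f) (@Phi R) A) /\
    is_persistence_intensity P f.
Proof.
split; first exact: measurable_Phi.
case: hf => mf f0 f1.
have [||Q QE] := @density_probability _ _ R (@lebesgue_Omega R)
  (fun x => (f x)%:E) _ _ f1.
- exact/measurable_EFinP.
- by move=> x; rewrite lee_fin.
exists (distribution Q (@Phi R)); split=> [A _|]; first exact: QE.
move=> d T Q' D DE; split=> // B mB; rewrite -QE /expectation_measure.
have mev := measurable_PD_eval _ _ mB.
(* Transport the mean to [PD], where it sees only the law of [D]; that law can then be replaced by
   the law of [Phi] under [Q]. *)
transitivity (\int[distribution Q' D]_E (E : PD R) B).
  by rewrite ge0_integral_distribution.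
rewrite (eq_measure_integral (distribution Q (@Phi R))); last first.
  by move=> A mA _; exact: DE.
(* Pulled back along [Phi], the integrand is the indicator of [B], whose integral is [Q B]. *)
rewrite ge0_integral_distribution//=.
under eq_integral do rewrite diracE.
by rewrite integral_indic// setIT.
Qed.
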